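(* Let $(\mathbb{X},\mathbb{T})$ be a tangent category with negatives, and let $H: T(M)\times_M E\to T(E)$ be a horizontal connection on a differential bundle $\mathsf{q}=(q:E\to M,+_q,0_q,\lambda)$. Let $U=\langle T(q),p\rangle:T(E)\to T(M)\times_M E$. Then the pair $(\{1-UH\},H)$ is a connection on $\mathsf{q}$ (where $1-UH$ is the difference formed in the bundle $p_E:T(E)\to E$, and the bracket $\{1-UH\}:T(E)\to E$ is well defined).
   Context: Conventions: composites are written in diagrammatic order ($fg$ means first $f$, then $g$). $\langle f,g\rangle$ is the induced map into a pullback, $\pi_0,\pi_1$ are projections, $h\times k=\langle\pi_0h,\pi_1k\rangle$ between pullbacks. Component subscripts of natural transformations are often omitted. An additive bundle over $M$ is a map $q:E\to M$ whose finite wide pullbacks $E_n$ along itself exist, with maps $+_q:E_2\to E$, $0_q:M\to E$ making $q$ a commutative monoid in the slice over $M$. An additive bundle morphism $(f_1,f_0)$ from $q:E\to M$ to $q':E'\to M'$ is a pair $f_1:E\to E'$, $f_0:M\to M'$ with $f_1q'=qf_0$ preserving addition and zero. A tangent category is a category with a functor $T$ and natural transformations $p:T\to 1$, $0:1\to T$, $+:T_2\to T$, $\ell:T\to T^2$, $c:T^2\to T^2$ such that: each $(p_M,+_M,0_M)$ is an additive bundle, the wide pullbacks $T_nM$ of $p_M$ exist and are preserved by each $T^k$; $(\ell_M,0_M)$ is an additive bundle morphism from $(p_M,+_M,0_M)$ to $(T(p_M),T(+_M),T(0_M))$; $(c_M,1)$ is an additive bundle morphism from $(T(p_M),T(+_M),T(0_M))$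 to $(p_{TM},+_{TM},0_{TM})$; $c^2=1$, $\ell c=\ell$, $\ell_M\ell_{TM}=\ell_MT(\ell_M)$, $T(c)cT(c)=cT(c)c$, $\ell_{TM}T(c_M)c_{TM}=c_MT(\ell_M)$; and the square with top $\langle\pi_0\ell,\pi_10\rangle T(+):T_2M\to T^2M$, left $\pi_0p=\pi_1p$, right $T(p)$, bottom $0_M$ is a pullback preserved by each $T^k$. It has negatives if there is a natural transformation $n:T\to T$ making each $p_M$ a fibrewise abelian group; $f-g:=\langle f,gn\rangle+$. A differential bundle $\mathsf{q}=(q:E\to M,+_q,0_q,\lambda)$ is an additive bundle with a lift $\lambda:E\to T(E)$ such that: the wide pullbacks $E_n$ are preserved by each $T^k$; for all $n,m$ the pullback of $E_n\to M$ along $T_mM\to M$ exists and is preserved by each $T^k$; $(\lambda,0_M)$ is an additive bundle morphism from $q$ to $(T(q),T(+_q),T(0_q))$; $(\lambda,0_q)$ is an additive bundle morphism from $q$ to $(p_E,+_E,0_E)$; with $\mu:=\langle\pi_0\lambda,\pi_10\rangle T(+_q):E_2\to T(E)$, the square with top $\mu$, left $\pi_0q=\pi_1q:E_2\to M$, right $T(q)$, bottom $0_M$ is a pullback (preserved by each $T^k$); and $\lambda\ell_E=\lambda T(\lambda)$. Consequently, for each $f:X\to T(E)$ with $fT(q)=fpq0$ there is a unique $f_{|\mu}:X\to E_2$ with $f_{|\mu}\mu=f$; the bracket is $\{f\}:=f_{|\mu}\pi_0:X\to E$. A vertical connection on $\mathsf{q}$ is a map $K:T(E)\to E$ with $\lambda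 K=1_E$, $Kq=pq$, $K\lambda=\ell T(K)$ and $K\lambda=T(\lambda)cT(K)$ (i.e. a retraction of $\lambda$ that is a linear bundle morphism for both bundle structures $p_E$ and $T(q)$ on $T(E)$). A horizontal connection is a map $H:T(M)\times_ME\to T(E)$ (pullback of $p_M$ and $q$, $\pi_0$ to $T(M)$, $\pi_1$ to $E$) with $HT(q)=\pi_0$, $Hp=\pi_1$, $H\ell=(\ell\times0)T(H)$ and $HT(\lambda)c=(0\times\lambda)T(H)$. A connection is a pair $(K,H)$ of a vertical and a horizontal connection with $HK=\pi_1q0_q$ and $\langle K,p\rangle\mu+UH=1_{T(E)}$ (sum in $p_E$), where $U=\langle T(q),p\rangle$. *)

(* Defs.v *)
From mathcomp Require Import all_boot.

Set Implicit Arguments.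
Unset Strict Implicit.
Unset Printing Implicit Defensive.

Declare Scope cat_scope.
Delimit Scope cat_scope with cat.
Local Open Scope cat_scope.

Reserved Notation "f ;; g" (at level 40, left associativity).

Record category := Category {
  ob :> Type;
  hom : ob -> ob -> Type;
  idm : forall A, hom A A;
  comp : forall A B D, hom A B -> hom B D -> hom A D;
  comp1m : forall A B (f : hom A B), comp (idm A) f = f;
  compm1 : forall A B (f : hom A B), comp f (idm B) = f;
  compA : forall A B D G (f : hom A B) (g : hom B D) (h : hom D G),
    comp f (comp g h) = comp (comp f g) h
}.

Arguments hom {c} A B.
Arguments idm {c} A.
Arguments comp {c A B D} f g.

(* Diagrammatic order: first [f], then [g]. *)
Notation "f ;; g" := (comp f g) : cat_scope.

Record functor (C D : category) := Functor {
  fobj :> C -> D;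
  fmap : forall A B : C, hom A B -> hom (fobj A) (fobj B);
  fmap1 : forall A : C, fmap (idm A) = idm (fobj A);
  fmapM : forall (A B G : C) (f : hom A B) (g : hom B G),
    fmap (f ;; g) = fmap f ;; fmap g
}.

Arguments fmap {C D} F {A B} f : rename.

Definition functor_id (C : category) : functor C C :=
  @Functor C C (fun A => A) (fun _ _ f => f)
    (fun _ => erefl) (fun _ _ _ _ _ => erefl).

Section FunctorComp.
Variables (C D G : category) (F : functor C D) (F' : functor D G).

Fact functor_comp1 (A : C) : fmap F' (fmap F (idm A)) = idm (F' (F A)).
Proof. by rewrite !fmap1. Qed.

Fact functor_compM (A B X : C) (f : hom A B) (g : hom B X) :
  fmap F' (fmap F (f ;; g)) = fmap F' (fmap F f) ;; fmap F' (fmap F g).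
Proof. by rewrite !fmapM. Qed.

Definition functor_comp : functor C G :=
  @Functor C G (fun A => F' (F A)) (fun _ _ f => fmap F' (fmap F f))
    functor_comp1 functor_compM.
End FunctorComp.

Fixpoint functor_iter (C : category) (F : functor C C) (k : nat) :
    functor C C :=
  if k is k'.+1 then functor_comp (functor_iter F k') F else functor_id C.

(* Universal properties are [Type]-valued: the mediating map is an operation,
   together with the equations and the uniqueness that determine it. *)

Record is_pullback (C : category) (A B D P : C)
    (f : hom A D) (g : hom B D) (a : hom P A) (b : hom P B) := IsPullback {
  pb_comm : a ;; f = b ;; g;
  pb_pair : forall (X : C) (x : hom X A) (y : hom X B),
    x ;; f = y ;; g -> hom X P;
  pb_pair0 : forall (X : C) (x : hom X A) (y : hom X B) (e : x ;; f = y ;; g),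
    pb_pair e ;; a = x;
  pb_pair1 : forall (X : C) (x : hom X A) (y : hom X B) (e : x ;; f = y ;; g),
    pb_pair e ;; b = y;
  pb_uniq : forall (X : C) (h h' : hom X P),
    h ;; a = h' ;; a -> h ;; b = h' ;; b -> h = h'
}.

(* The limit of [n] copies of [q] over [M], with its leg [base] to [M]; for
   [n = 0] it is [M] itself, up to isomorphism. *)
Record is_wide_pullback (C : category) (E M : C) (q : hom E M) (n : nat)
    (P : C) (base : hom P M) (pr : 'I_n -> hom P E) := IsWidePullback {
  wp_comm : forall i, pr i ;; q = base;
  wp_lift : forall (X : C) (b : hom X M) (f : 'I_n -> hom X E),
    (forall i, f i ;; q = b) -> hom X P;
  wp_lift_base : forall (X : C) (b : hom X M) (f : 'I_n -> hom X E)
    (e : forall i, f i ;; q = b), wp_lift e ;; base = b;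
  wp_lift_pr : forall (X : C) (b : hom X M) (f : 'I_n -> hom X E)
    (e : forall i, f i ;; q = b) i, wp_lift e ;; pr i = f i;
  wp_uniq : forall (X : C) (h h' : hom X P),
    h ;; base = h' ;; base -> (forall i, h ;; pr i = h' ;; pr i) -> h = h'
}.

Record wide_pullback (C : category) (E M : C) (q : hom E M) (n : nat) :=
  WidePullback {
  wp_ob :> C;
  wp_base : hom wp_ob M;
  wp_pr : 'I_n -> hom wp_ob E;
  wp_univ :> is_wide_pullback q wp_base wp_pr
}.

Arguments wp_base {C E M q n} w.
Arguments wp_pr {C E M q n} w i.

Section WidePair.
Variables (C : category) (E M : C) (q : hom E M).
Variable W : wide_pullback q 2.

Definition wpi0 : hom W E := wp_pr W (@Ordinal 2 0 isT).
Definition wpi1 : hom W E := wp_pr W (@Ordinal 2 1 isT).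

Lemma wpi_comm : wpi0 ;; q = wpi1 ;; q.
Proof. by rewrite /wpi0 /wpi1 !(wp_comm W). Qed.

Fact wpair_subproof (X : C) (f g : hom X E) (e : f ;; q = g ;; q) (i : 'I_2) :
  (if i == 0 :> nat then f else g) ;; q = f ;; q.
Proof. by case: ifP. Qed.

Definition wpair (X : C) (f g : hom X E) (e : f ;; q = g ;; q) : hom X W :=
  wp_lift W (wpair_subproof e).

Lemma wpair0 (X : C) (f g : hom X E) (e : f ;; q = g ;; q) :
  wpair e ;; wpi0 = f.
Proof. exact: (wp_lift_pr W (wpair_subproof e)). Qed.

Lemma wpair1 (X : C) (f g : hom X E) (e : f ;; q = g ;; q) :
  wpair e ;; wpi1 = g.
Proof. exact: (wp_lift_pr W (wpair_subproof e)). Qed.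

Lemma wpair_base (X : C) (f g : hom X E) (e : f ;; q = g ;; q) :
  wpair e ;; wp_base W = f ;; q.
Proof. exact: (wp_lift_base W (wpair_subproof e)). Qed.

Lemma wpair_uniq (X : C) (h h' : hom X W) :
  h ;; wpi0 = h' ;; wpi0 -> h ;; wpi1 = h' ;; wpi1 -> h = h'.
Proof.
move=> e0 e1; apply: (wp_uniq W) => [|[[|[|//]] lti]].
- by rewrite -(wp_comm W (@Ordinal 2 0 isT)) !compA [h ;; _]e0.
- by rewrite (_ : Ordinal lti = @Ordinal 2 0 isT) //; apply: val_inj.
- by rewrite (_ : Ordinal lti = @Ordinal 2 1 isT) //; apply: val_inj.
Qed.
End WidePair.

Record bundle_ops (C : category) (E M : C) (q : hom E M) := BundleOps {
  bpow : forall n, wide_pullback q n;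
  badd : hom (bpow 2) E;
  bzero : hom M E;
  badd_over : badd ;; q = wp_base (bpow 2);
  bzero_over : bzero ;; q = idm M
}.

Arguments bpow {C E M q} b n.
Arguments badd {C E M q} b.
Arguments bzero {C E M q} b.

Section BundlePlus.
Variables (C : category) (E M : C) (q : hom E M) (B : bundle_ops q).

Definition bpi0 : hom (bpow B 2) E := wpi0 (bpow B 2).
Definition bpi1 : hom (bpow B 2) E := wpi1 (bpow B 2).
Definition bpair (X : C) (f g : hom X E) (e : f ;; q = g ;; q) :
  hom X (bpow B 2) := wpair (bpow B 2) e.

Definition bplus (X : C) (f g : hom X E) (e : f ;; q = g ;; q) : hom X E :=
  bpair e ;; badd B.

Lemma bplus_over (X : C) (f g : hom X E) (e : f ;; q = g ;; q) :
  bplus e ;; q = f ;; q.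
Proof. by rewrite /bplus -compA badd_over wpair_base. Qed.

Lemma bplus_congr (X : C) (f f' g g' : hom X E)
    (e : f ;; q = g ;; q) (e' : f' ;; q = g' ;; q) :
  f = f' -> g = g' -> bplus e = bplus e'.
Proof.
by move=> ef eg; subst; congr (_ ;; _); apply: wpair_uniq;
  rewrite /bpair ?wpair0 ?wpair1.
Qed.

Definition bpi3 (i : 'I_3) : hom (bpow B 3) E := wp_pr (bpow B 3) i.

Lemma bpi3_comm i j : bpi3 i ;; q = bpi3 j ;; q.
Proof. by rewrite /bpi3 !(wp_comm (bpow B 3)). Qed.

Lemma bplus_overl (X : C) (f g h : hom X E) (e : f ;; q = g ;; q) :
  f ;; q = h ;; q -> bplus e ;; q = h ;; q.
Proof. by rewrite bplus_over. Qed.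

Lemma bplus_overr (X : C) (f g h : hom X E) (e : g ;; q = h ;; q) :
  f ;; q = g ;; q -> f ;; q = bplus e ;; q.
Proof. by rewrite bplus_over. Qed.

Lemma bunit_compat : idm E ;; q = (q ;; bzero B) ;; q.
Proof. by rewrite -compA bzero_over compm1 comp1m. Qed.
End BundlePlus.

Arguments bpi0 {C E M q} B.
Arguments bpi1 {C E M q} B.
Arguments bpi3 {C E M q} B i.

Record additive_bundle (C : category) (E M : C) (q : hom E M) :=
  AdditiveBundle {
  ab_ops :> bundle_ops q;
  ab_assoc :
    let x := bpi3 ab_ops (@Ordinal 3 0 isT) in
    let y := bpi3 ab_ops (@Ordinal 3 1 isT) in
    let z := bpi3 ab_ops (@Ordinal 3 2 isT) in
    let exy : x ;; q = y ;; q := bpi3_comm _ _ _ in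
    let eyz : y ;; q = z ;; q := bpi3_comm _ _ _ in
    let exz : x ;; q = z ;; q := bpi3_comm _ _ _ in
    bplus ab_ops (bplus_overl ab_ops exy exz)
    = bplus ab_ops (bplus_overr ab_ops eyz exy);
  ab_comm :
    bplus ab_ops (esym (wpi_comm (bpow ab_ops 2))) = badd ab_ops;
  ab_unit :
    bplus ab_ops (bunit_compat ab_ops) = idm E
}.

Section AdditiveMorphism.
Variables (C : category) (E M E' M' : C) (q : hom E M) (q' : hom E' M').
Variables (B : additive_bundle q) (B' : additive_bundle q').
Variables (f1 : hom E E') (f0 : hom M M').

Lemma amor_compat : f1 ;; q' = q ;; f0 ->
  (bpi0 B ;; f1) ;; q' = (bpi1 B ;; f1) ;; q'.
Proof. by move=> e; rewrite -!compA e !compA (wpi_comm (bpow B 2)). Qed.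

Record additive_morphism : Prop := AdditiveMorphism {
  amor_over : f1 ;; q' = q ;; f0;
  amor_add : badd B ;; f1 = bplus B' (amor_compat amor_over);
  amor_zero : bzero B ;; f1 = f0 ;; bzero B'
}.
End AdditiveMorphism.

Definition preserves_wide_pullbacks (C D : category) (F : functor C D)
    (E M : C) (q : hom E M) (W : forall n, wide_pullback q n) :=
  forall n, is_wide_pullback (fmap F q) (fmap F (wp_base (W n)))
              (fun i => fmap F (wp_pr (W n) i)).

Section BundleImage.
Variables (C D : category) (F : functor C D) (E M : C) (q : hom E M).
Variable B : additive_bundle q.
Hypothesis pres : preserves_wide_pullbacks F (bpow B).

Definition image_pow n : wide_pullback (fmap F q) n := WidePullback (pres n).

Fact image_add_over :
  (fmap F (badd B) : hom (image_pow 2) (F E)) ;; fmap F q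
  = wp_base (image_pow 2).
Proof. by rewrite -[LHS]fmapM badd_over. Qed.

Fact image_zero_over : fmap F (bzero B) ;; fmap F q = idm (F M).
Proof. by rewrite -fmapM bzero_over fmap1. Qed.

Definition image_ops : bundle_ops (fmap F q) :=
  @BundleOps D (F E) (F M) (fmap F q) image_pow (fmap F (badd B))
    (fmap F (bzero B)) image_add_over image_zero_over.

Lemma image_bplus (X : C) (f g : hom X E) (e : f ;; q = g ;; q)
    (e' : fmap F f ;; fmap F q = fmap F g ;; fmap F q) :
  bplus image_ops e' = fmap F (bplus B e).
Proof.
rewrite /bplus fmapM; congr (_ ;; _); apply: wpair_uniq.
- by rewrite /bpair wpair0 [RHS]/= -[RHS]fmapM wpair0.
- by rewrite /bpair wpair1 [RHS]/= -[RHS]fmapM wpair1.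
Qed.

Fact fmap_over (X : C) (f g : hom X E) :
  f ;; q = g ;; q -> fmap F f ;; fmap F q = fmap F g ;; fmap F q.
Proof. by move=> e; rewrite -!fmapM e. Qed.

Definition image_bundle : additive_bundle (fmap F q).
Proof.
refine (@AdditiveBundle _ _ _ _ image_ops _ _ _).
- move=> x y z exy eyz exz.
  pose e01 := bpi3_comm B (@Ordinal 3 0 isT) (@Ordinal 3 1 isT).
  pose e12 := bpi3_comm B (@Ordinal 3 1 isT) (@Ordinal 3 2 isT).
  pose e02 := bpi3_comm B (@Ordinal 3 0 isT) (@Ordinal 3 2 isT).
  rewrite (bplus_congr _ _ (fmap_over (bplus_overl B e01 e02))); first last.
  + by [].
  + exact: image_bplus.
  rewrite [RHS](bplus_congr _ _ (fmap_over (bplus_overr B e12 e01))); first last.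
  + exact: image_bplus.
  + by [].
  by rewrite (image_bplus (bplus_overl B e01 e02))
    (image_bplus (bplus_overr B e12 e01)) (ab_assoc B).
- rewrite (bplus_congr _ _ (fmap_over (esym (wpi_comm (bpow B 2))))) //.
  by rewrite (image_bplus (esym (wpi_comm (bpow B 2)))) (ab_comm B).
- rewrite (bplus_congr _ _ (fmap_over (bunit_compat B))) ?fmap1 ?fmapM //.
  by rewrite (image_bplus (bunit_compat B)) ab_unit fmap1.
Defined.
End BundleImage.

(* A pullback preserved by each [T^k]; [k = 0] says that it is a pullback. *)
Definition stable_pullback (C : category) (T : functor C C) (A B D P : C)
    (f : hom A D) (g : hom B D) (a : hom P A) (b : hom P B) :=
  forall k, is_pullback (fmap (functor_iter T k) f) (fmap (functor_iter T k) g)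
              (fmap (functor_iter T k) a) (fmap (functor_iter T k) b).

Definition stable_powers (C : category) (T : functor C C) (E M : C)
    (q : hom E M) (B : additive_bundle q) :=
  forall k, preserves_wide_pullbacks (functor_iter T k) (bpow B).

Definition tangent_image (C : category) (T : functor C C) (E M : C)
    (q : hom E M) (B : additive_bundle q) (s : stable_powers T B) :
  additive_bundle (fmap T q) := @image_bundle C C T E M q B (s 1).

(* For an additive bundle [q] with a map [l : E -> T E] and a zero
   [0 : 1 -> T], the map [mu = <pi0 l, pi1 0> T(+) : E_2 -> T E]. *)
Section Mu.
Variables (C : category) (T : functor C C) (E M : C) (q : hom E M).
Variables (B : additive_bundle q) (s : stable_powers T B).
Variables (l z : hom E (T E)) (z0 : hom M (T M)).
Hypotheses (l_over : l ;; fmap T q = q ;; z0).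
Hypotheses (z_over : z ;; fmap T q = q ;; z0).

Fact mu_compat : (bpi0 B ;; l) ;; fmap T q = (bpi1 B ;; z) ;; fmap T q.
Proof.
by rewrite -!compA l_over z_over !compA (wpi_comm (bpow B 2)).
Qed.

Definition mu_map : hom (bpow B 2) (T E) := bplus (tangent_image s) mu_compat.
End Mu.

Lemma nat_pair_compat (C : category) (E M E' M' : C) (q : hom E M)
    (q' : hom E' M') (B : additive_bundle q) (f1 : hom E E') (f0 : hom M M') :
  q ;; f0 = f1 ;; q' -> (bpi0 B ;; f1) ;; q' = (bpi1 B ;; f1) ;; q'.
Proof. by move=> e; apply: (@amor_compat _ _ _ _ _ _ _ B f1 f0). Qed.

Record tangent_structure (C : category) := TangentStructure {
  tfun :> functor C C;
  tp : forall M : C, hom (tfun M) M;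
  tp_nat : forall (M N : C) (f : hom M N), tp M ;; f = fmap tfun f ;; tp N;
  tbundle : forall M : C, additive_bundle (tp M);
  tpow_stable : forall M : C, stable_powers tfun (tbundle M);
  tzero_nat : forall (M N : C) (f : hom M N),
    bzero (tbundle M) ;; fmap tfun f = f ;; bzero (tbundle N);
  tadd_nat : forall (M N : C) (f : hom M N),
    badd (tbundle M) ;; fmap tfun f
    = bpair (tbundle N) (nat_pair_compat (tbundle M) (tp_nat f))
        ;; badd (tbundle N);
  tl : forall M : C, hom (tfun M) (tfun (tfun M));
  tl_nat : forall (M N : C) (f : hom M N),
    tl M ;; fmap tfun (fmap tfun f) = fmap tfun f ;; tl N;
  tc : forall M : C, hom (tfun (tfun M)) (tfun (tfun M));
  tc_nat : forall (M N : C) (f : hom M N),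
    tc M ;; fmap tfun (fmap tfun f) = fmap tfun (fmap tfun f) ;; tc N;
  tl_additive : forall M : C,
    additive_morphism (tbundle M) (tangent_image (tpow_stable M))
      (tl M) (bzero (tbundle M));
  tc_additive : forall M : C,
    additive_morphism (tangent_image (tpow_stable M)) (tbundle (tfun M))
      (tc M) (idm (tfun M));
  tcc : forall M : C, tc M ;; tc M = idm (tfun (tfun M));
  tlc : forall M : C, tl M ;; tc M = tl M;
  tll : forall M : C, tl M ;; tl (tfun M) = tl M ;; fmap tfun (tl M);
  tccc : forall M : C,
    fmap tfun (tc M) ;; tc (tfun M) ;; fmap tfun (tc M)
    = tc (tfun M) ;; fmap tfun (tc M) ;; tc (tfun M);
  tlcc : forall M : C,
    tl (tfun M) ;; fmap tfun (tc M) ;; tc (tfun M) = tc M ;; fmap tfun (tl M);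
  tl_universal : forall M : C,
    stable_pullback tfun (bzero (tbundle M)) (fmap tfun (tp M))
      (wp_base (bpow (tbundle M) 2))
      (mu_map (tpow_stable M) (amor_over (tl_additive M)) (tzero_nat (tp M)))
}.

Arguments tp {C} t M.
Arguments tbundle {C} t M.
Arguments tpow_stable {C} t M k : rename.
Arguments tl {C} t M.
Arguments tc {C} t M.

Definition tzero (C : category) (T : tangent_structure C) (M : C) :
  hom M (T M) := bzero (tbundle T M).

Fact neg_compat (C : category) (T : tangent_structure C) (M : C)
    (n : hom (T M) (T M)) :
  n ;; tp T M = tp T M -> idm (T M) ;; tp T M = n ;; tp T M.
Proof. by move->; rewrite comp1m. Qed.

Record negatives (C : category) (T : tangent_structure C) := Negatives {
  tneg : forall M : C, hom (T M) (T M);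
  tneg_nat : forall (M N : C) (f : hom M N),
    tneg M ;; fmap T f = fmap T f ;; tneg N;
  tneg_over : forall M : C, tneg M ;; tp T M = tp T M;
  tneg_inv : forall M : C,
    bplus (tbundle T M) (neg_compat (tneg_over M)) = tp T M ;; tzero T M
}.

Arguments tneg {C T} n M.

Fact tsub_compat (C : category) (T : tangent_structure C) (N : negatives T)
    (X M : C) (f g : hom X (T M)) :
  f ;; tp T M = g ;; tp T M -> f ;; tp T M = (g ;; tneg N M) ;; tp T M.
Proof. by rewrite -compA tneg_over. Qed.

Definition tsub (C : category) (T : tangent_structure C) (N : negatives T)
    (X M : C) (f g : hom X (T M)) (e : f ;; tp T M = g ;; tp T M) :
  hom X (T M) := bplus (tbundle T M) (tsub_compat N e).

Record differential_bundle (C : category) (T : tangent_structure C) (E M : C)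
    (q : hom E M) := DifferentialBundle {
  db_bundle :> additive_bundle q;
  db_lift : hom E (T E);
  db_pow_stable : stable_powers T db_bundle;
  db_pb : nat -> nat -> C;
  db_pb0 : forall n m, hom (db_pb n m) (bpow (tbundle T M) m);
  db_pb1 : forall n m, hom (db_pb n m) (bpow db_bundle n);
  db_pb_stable : forall n m,
    stable_pullback T (wp_base (bpow (tbundle T M) m))
      (wp_base (bpow db_bundle n)) (db_pb0 n m) (db_pb1 n m);
  db_lift_additive :
    additive_morphism db_bundle (tangent_image db_pow_stable)
      db_lift (tzero T M);
  db_lift_additive_p :
    additive_morphism db_bundle (tbundle T E) db_lift (bzero db_bundle);
  db_universal :
    stable_pullback T (tzero T M) (fmap T q) (wp_base (bpow db_bundle 2))
      (mu_map db_pow_stable (amor_over db_lift_additive) (tzero_nat T q));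
  db_lift_lift : db_lift ;; tl T E = db_lift ;; fmap T db_lift
}.

Section DifferentialBundle.
Variables (C : category) (T : tangent_structure C) (E M : C) (q : hom E M).
Variable Q : differential_bundle T q.

Definition mu : hom (bpow Q 2) (T E) :=
  mu_map (db_pow_stable Q) (amor_over (db_lift_additive Q)) (tzero_nat T q).

Lemma mu_p : mu ;; tp T E = bpi1 Q.
Proof.
have gen (h : hom (bpow Q 2) (T (bpow Q 2))) :
    h ;; fmap T (bpi0 Q) = bpi0 Q ;; db_lift Q ->
    h ;; fmap T (bpi1 Q) = bpi1 Q ;; tzero T E ->
    h ;; fmap T (badd Q) ;; tp T E = bpi1 Q.
  have pairE0 X (f g : hom X E) (e : f ;; q = g ;; q) :
    bpair Q e ;; wpi0 (bpow Q 2) = f := wpair0 _ e.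
  have pairE1 X (f g : hom X E) (e : f ;; q = g ;; q) :
    bpair Q e ;; wpi1 (bpow Q 2) = g := wpair1 _ e.
  move=> h0 h1; rewrite -compA -tp_nat compA -[RHS]compm1 -(ab_unit Q).
  rewrite -(ab_comm Q) /bplus !compA; congr (_ ;; _); apply: wpair_uniq.
  - rewrite -!compA !pairE0 compm1 -/(bpi1 Q) tp_nat compA h1 -compA.
    by rewrite [tzero T E ;; _]bzero_over compm1.
  - rewrite -!compA !pairE1 -/(bpi0 Q) tp_nat compA h0 -compA.
    rewrite (amor_over (db_lift_additive_p Q)) !compA.
    by congr (_ ;; _); apply: wpi_comm.
pose W : wide_pullback (fmap T q) 2 := image_pow (db_pow_stable Q 1) 2.
pose e := mu_compat Q (amor_over (db_lift_additive Q)) (tzero_nat T q).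
exact: (gen _ (wpair0 W e) (wpair1 W e)).
Qed.

(* [f_{|mu}] and the bracket [{f}], for [f T(q) = f p q 0]. *)
Section Bracket.
Variables (X : C) (f : hom X (T E)).
Hypothesis e : f ;; fmap T q = f ;; tp T E ;; q ;; tzero T M.

Definition mu_factor : hom X (bpow Q 2) :=
  @pb_pair _ _ _ _ _ _ _ _ _ (db_universal Q 0) X (f ;; tp T E ;; q) f (esym e).

Definition bracket : hom X E := mu_factor ;; bpi0 Q.
End Bracket.

Lemma mu_factorK (X : C) (f : hom X (T E))
    (e : f ;; fmap T q = f ;; tp T E ;; q ;; tzero T M) :
  mu_factor e ;; mu = f.
Proof. exact: (pb_pair1 (db_universal Q 0)). Qed.

Lemma mu_factor_uniq (X : C) (h h' : hom X (bpow Q 2)) :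
  h ;; mu = h' ;; mu -> h = h'.
Proof.
move=> eh; apply: (pb_uniq (db_universal Q 0)); last exact: eh.
change (h ;; wp_base (bpow Q 2) = h' ;; wp_base (bpow Q 2)).
rewrite -(wp_comm (bpow Q 2) (@Ordinal 2 1 isT)) !compA.
have : (h ;; mu) ;; tp T E = (h' ;; mu) ;; tp T E by rewrite eh.
by rewrite -(compA h) -(compA h') mu_p => e1; congr (_ ;; q).
Qed.

(* The pullback [T(M) x_M E] of [p_M] and [q] is the one given for
   [n = m = 1], via [T_1 M ~ T M] and [E_1 ~ E]. *)
Definition TME : C := db_pb Q 1 1.
Definition tme0 : hom TME (T M) :=
  db_pb0 Q 1 1 ;; wp_pr (bpow (tbundle T M) 1) ord0.
Definition tme1 : hom TME E := db_pb1 Q 1 1 ;; wp_pr (bpow Q 1) ord0.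

Section TmeStable.
Variable k : nat.
Let F := functor_iter T k.
Let sp : is_wide_pullback _ _ _ := tpow_stable T M k 1.
Let sq : is_wide_pullback _ _ _ := db_pow_stable Q k 1.
Let sb : is_pullback _ _ _ _ := db_pb_stable Q 1 1 k.

Fact tme_comm : fmap F tme0 ;; fmap F (tp T M) = fmap F tme1 ;; fmap F q.
Proof.
rewrite /tme0 /tme1 -!fmapM -!compA (wp_comm (bpow (tbundle T M) 1)).
by rewrite (wp_comm (bpow Q 1)) !fmapM (pb_comm sb).
Qed.

Variables (X : C) (x : hom X (F (T M))) (y : hom X (F E)).
Hypothesis e : x ;; fmap F (tp T M) = y ;; fmap F q.

Let x1 : hom X (F (bpow (tbundle T M) 1)) :=
  wp_lift sp (fun _ : 'I_1 => erefl (x ;; fmap F (tp T M))).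
Let y1 : hom X (F (bpow Q 1)) :=
  wp_lift sq (fun _ : 'I_1 => erefl (y ;; fmap F q)).

Fact tme_pair_compat :
  x1 ;; fmap F (wp_base (bpow (tbundle T M) 1))
  = y1 ;; fmap F (wp_base (bpow Q 1)).
Proof. by rewrite (wp_lift_base sp) (wp_lift_base sq). Qed.

Definition tme_lift : hom X (F TME) := pb_pair sb tme_pair_compat.

Fact tme_lift0 : tme_lift ;; fmap F tme0 = x.
Proof.
by rewrite /tme0 fmapM compA (pb_pair0 sb) (wp_lift_pr sp).
Qed.

Fact tme_lift1 : tme_lift ;; fmap F tme1 = y.
Proof.
by rewrite /tme1 fmapM compA (pb_pair1 sb) (wp_lift_pr sq).
Qed.
End TmeStable.

Fact tme_uniq k (F := functor_iter T k) (X : C) (h h' : hom X (F TME)) :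
  h ;; fmap F tme0 = h' ;; fmap F tme0 ->
  h ;; fmap F tme1 = h' ;; fmap F tme1 -> h = h'.
Proof.
rewrite /tme0 /tme1 !fmapM !compA => e0 e1.
apply: (pb_uniq (db_pb_stable Q 1 1 k)).
- apply: (wp_uniq (tpow_stable T M k 1)) => [|i]; last by rewrite (ord1 i).
  by rewrite -(wp_comm (tpow_stable T M k 1) ord0) !compA e0.
- apply: (wp_uniq (db_pow_stable Q k 1)) => [|i]; last by rewrite (ord1 i).
  by rewrite -(wp_comm (db_pow_stable Q k 1) ord0) !compA e1.
Qed.

Definition tme_stable : stable_pullback T (tp T M) q tme0 tme1 :=
  fun k => IsPullback (tme_comm k) (@tme_lift0 k) (@tme_lift1 k)
             (@tme_uniq k).

Definition tme_pair (X : C) (x : hom X (T M)) (y : hom X E)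
    (e : x ;; tp T M = y ;; q) : hom X TME :=
  @pb_pair _ _ _ _ _ _ _ _ _ (tme_stable 0) X x y e.

(* [T(T(M) x_M E)] is a pullback of [T(p_M)] and [T(q)]. *)
Definition tme_Tpair (X : C) (x : hom X (T (T M))) (y : hom X (T E))
    (e : x ;; fmap T (tp T M) = y ;; fmap T q) : hom X (T TME) :=
  @pb_pair _ _ _ _ _ _ _ _ _ (tme_stable 1) X x y e.

Record vertical_connection (K : hom (T E) E) : Prop := VerticalConnection {
  vc_retract : db_lift Q ;; K = idm E;
  vc_over : K ;; q = tp T E ;; q;
  vc_linear_p : K ;; db_lift Q = tl T E ;; fmap T K;
  vc_linear_Tq : K ;; db_lift Q = fmap T (db_lift Q) ;; tc T E ;; fmap T K
}.

Lemma tme_comm0 : tme0 ;; tp T M = tme1 ;; q.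
Proof. exact: (tme_comm 0). Qed.

Fact lx0_compat : (tme0 ;; tl T M) ;; fmap T (tp T M)
  = (tme1 ;; tzero T E) ;; fmap T q.
Proof.
rewrite -!compA (amor_over (tl_additive T M)) tzero_nat !compA.
by rewrite tme_comm0.
Qed.

Fact zxl_compat : (tme0 ;; tzero T (T M)) ;; fmap T (tp T M)
  = (tme1 ;; db_lift Q) ;; fmap T q.
Proof.
rewrite -!compA (amor_over (db_lift_additive Q)) tzero_nat !compA.
by rewrite tme_comm0.
Qed.

(* [l x 0] and [0 x lambda], with codomain [T(T(M) x_M E)] in place of the
   isomorphic pullbacks of [T(p_M)] and [T(q)]. *)
Definition l_times_zero : hom TME (T TME) := tme_Tpair lx0_compat.
Definition zero_times_lift : hom TME (T TME) := tme_Tpair zxl_compat.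

Record horizontal_connection (H : hom TME (T E)) : Prop :=
  HorizontalConnection {
  hc_Tq : H ;; fmap T q = tme0;
  hc_p : H ;; tp T E = tme1;
  hc_linear_p : H ;; tl T E = l_times_zero ;; fmap T H;
  hc_linear_Tq :
    H ;; fmap T (db_lift Q) ;; tc T E = zero_times_lift ;; fmap T H
}.

Definition U : hom (T E) TME := tme_pair (esym (tp_nat T q)).

Lemma U0 : U ;; tme0 = fmap T q.
Proof. exact: (pb_pair0 (tme_stable 0)). Qed.

Lemma U1 : U ;; tme1 = tp T E.
Proof. exact: (pb_pair1 (tme_stable 0)). Qed.

Lemma UH_p (H : hom TME (T E)) :
  horizontal_connection H -> (U ;; H) ;; tp T E = tp T E.
Proof. by move=> hH; rewrite -compA hc_p // U1. Qed.

Fact connection_compat (K : hom (T E) E) (H : hom TME (T E))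
    (hK : vertical_connection K) (hH : horizontal_connection H) :
  (bpair Q (vc_over hK) ;; mu) ;; tp T E = (U ;; H) ;; tp T E.
Proof. by rewrite UH_p // -compA mu_p [LHS]wpair1. Qed.

Record connection (K : hom (T E) E) (H : hom TME (T E)) : Prop := Connection {
  cn_vertical : vertical_connection K;
  cn_horizontal : horizontal_connection H;
  cn_HK : H ;; K = tme1 ;; q ;; bzero Q;
  cn_sum :
    bplus (tbundle T E) (connection_compat cn_vertical cn_horizontal)
    = idm (T E)
}.

Fact one_sub_UH_compat (H : hom TME (T E)) : horizontal_connection H ->
  idm (T E) ;; tp T E = (U ;; H) ;; tp T E.
Proof. by move=> hH; rewrite UH_p // comp1m. Qed.

Definition one_sub_UH (N : negatives T) (H : hom TME (T E))
    (hH : horizontal_connection H) : hom (T E) (T E) :=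
  tsub N (one_sub_UH_compat hH).
End DifferentialBundle.

(* Main.v *)
From mathcomp Require Import all_boot.
Require Import Defs.
Local Open Scope cat_scope.

(** Write [f] for [1 - UH] and [K] for the bracket [{f}]. The only property of
    [f] that the argument uses is [f + UH = 1] in the bundle [p_E]
    ([tsub_addK]): since [p_E] is a group bundle, this equation can be
    transported along additive maps and [UH] cancelled, so every fact about [f]
    follows from the corresponding fact about [UH].

    - Applying [T(q)] gives [f T(q) = p q 0], because [UH T(q) = T(q)]; so the
      bracket exists, and [f = <K,p> mu]. The splitting
      [<K,p> mu + UH = 1] is then the defining equation of [f].
    - Precomposing with [H] gives [H f = 0], because [HU = 1]; as
      [<x q 0_q, x> mu = x 0], the injectivity of [mu] yields
      [HK = pi_1 q 0_q].
    - Precomposing with [lambda] gives [lambda f = lambda]: a horizontal lift of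
      a zero vector is zero ([hc_zero]), so [lambda UH] is zero. As
      [<x, x q 0_q> mu = x lambda], the injectivity of [mu] yields
      [lambda K = 1].

    The two linearity conditions on [K] are one computation for two maps
    [a : T(E) -> T^2(E)], namely [l] and [T(lambda) c]. The linearity of [H]
    says that [UH] commutes with [a], hence so does [f] ([complement_comm]):
    [a T(f) = f a]. On the other side, [mu a = v T(mu)] for a map
    [v : E_2 -> T(E_2)], equal to [lambda x 0] for [l] ([mu_tl]) and to
    [lambda x lambda] for [T(lambda) c] ([mu_Tlift_tc]). Writing
    [f = <K,p> mu] on both sides of [a T(f) = f a] and cancelling [T(mu)] gives
    [a T(<K,p>) = <K,p> v], whose first component is [a T(K) = K lambda]
    ([bracket_comm]). *)

Set Implicit Arguments.
Unset Strict Implicit.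
Unset Printing Implicit Defensive.

(** * Sums as a relation *)

(** For [a], [b] the projections of a pullback [E_2] and [s] an addition, this
    says that [z] is the sum of [x] and [y]. As a relation, it makes no mention
    of a proof that [x] and [y] lie over the same base map, and it makes sense
    for the images of [a], [b], [s] under any functor, so that additive maps
    act on it without any transport. *)
Definition sum_rel (C : category) (P E X : C) (a b s : hom P E)
    (x y z : hom X E) : Prop :=
  exists h : hom X P, [/\ h ;; a = x, h ;; b = y & h ;; s = z].

Section SumRel.
Variable C : category.

Lemma sum_rel_pre (P E X Y : C) (a b s : hom P E) (x y z : hom X E)
    (f : hom Y X) :
  sum_rel a b s x y z -> sum_rel a b s (f ;; x) (f ;; y) (f ;; z).
Proof. by case=> h [<- <- <-]; exists (f ;; h); rewrite !compA. Qed.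

(** It suffices to check that [g] is additive on the generic pair, given by the
    two projections. *)
Lemma sum_rel_post (P E P' E' X : C) (a b s : hom P E) (a' b' s' : hom P' E')
    (g : hom E E') (x y z : hom X E) :
  sum_rel a' b' s' (a ;; g) (b ;; g) (s ;; g) ->
  sum_rel a b s x y z -> sum_rel a' b' s' (x ;; g) (y ;; g) (z ;; g).
Proof.
by move=> sg [h [<- <- <-]]; rewrite -!compA; apply: sum_rel_pre.
Qed.

Lemma sum_rel_fmap (D : category) (F : functor C D) (P E X : C)
    (a b s : hom P E) (x y z : hom X E) :
  sum_rel a b s x y z ->
  sum_rel (fmap F a) (fmap F b) (fmap F s) (fmap F x) (fmap F y) (fmap F z).
Proof. by case=> h [<- <- <-]; exists (fmap F h); rewrite !fmapM. Qed.

Lemma sum_rel_fun (E M : C) (q : hom E M) (W : wide_pullback q 2)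
    (s : hom W E) (X : C) (x y z z' : hom X E) :
  sum_rel (wpi0 W) (wpi1 W) s x y z -> sum_rel (wpi0 W) (wpi1 W) s x y z' ->
  z = z'.
Proof.
move=> [h [h0 h1 <-]] [h' [h0' h1' <-]]; congr (_ ;; _).
by apply: wpair_uniq; rewrite ?h0 ?h0' ?h1 ?h1'.
Qed.
End SumRel.

Notation bsum B := (sum_rel (bpi0 B) (bpi1 B) (badd B)).
Notation Tbsum T B :=
  (sum_rel (fmap T (bpi0 B)) (fmap T (bpi1 B)) (fmap T (badd B))).

(** * Commutative monoid laws in an additive bundle *)

Section BundleSum.
Variables (C : category) (E M : C) (q : hom E M) (B : additive_bundle q).

Lemma bsum_bplus (X : C) (x y : hom X E) (e : x ;; q = y ;; q) :
  bsum B x y (bplus B e).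
Proof. by exists (bpair B e); split; rewrite // ?[LHS]wpair0 ?[LHS]wpair1. Qed.

Lemma bplus_bsum (X : C) (x y z : hom X E) (e : x ;; q = y ;; q) :
  bsum B x y z -> bplus B e = z.
Proof. exact: (@sum_rel_fun _ _ _ _ (bpow B 2) _ _ _ _ _ _ (bsum_bplus e)). Qed.

Lemma bsum_fun (X : C) (x y z z' : hom X E) :
  bsum B x y z -> bsum B x y z' -> z = z'.
Proof. exact: (@sum_rel_fun _ _ _ _ (bpow B 2)). Qed.

Lemma bsum_overl (X : C) (x y z : hom X E) : bsum B x y z -> z ;; q = x ;; q.
Proof.
case=> h [<- _ <-].
by rewrite -!compA badd_over (wp_comm (bpow B 2)).
Qed.

Lemma bsum_over (X : C) (x y z : hom X E) : bsum B x y z -> x ;; q = y ;; q.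
Proof. by case=> h [<- <- _]; rewrite -!compA (wpi_comm (bpow B 2)). Qed.

Lemma bsumC (X : C) (x y z : hom X E) : bsum B x y z -> bsum B y x z.
Proof.
case=> h [<- <- <-]; apply: sum_rel_pre.
rewrite -[X in sum_rel _ _ _ _ _ X](ab_comm B).
exact: (bsum_bplus (esym (wpi_comm (bpow B 2)))).
Qed.

(** The associativity axiom concerns the three projections of [E_3]; it is
    pulled back along the map [<x,y,z>] into [E_3]. *)
Lemma bsumA (X : C) (x y z xy yz w : hom X E) :
  bsum B x y xy -> bsum B y z yz -> bsum B xy z w -> bsum B x yz w.
Proof.
move=> sxy syz sw.
pose f (i : 'I_3) :=
  if i == 0 :> nat then x else if i == 1 :> nat then y else z.
have ef i : f i ;; q = y ;; q.
  rewrite /f; case: ifP => _; first exact: bsum_over sxy.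
  by case: ifP => _ //; rewrite (bsum_over syz).
pose h := wp_lift (bpow B 3) ef.
have hE i : h ;; bpi3 B i = f i by apply: wp_lift_pr.
pose i0 : 'I_3 := @Ordinal 3 0 isT.
pose i1 : 'I_3 := @Ordinal 3 1 isT.
pose i2 : 'I_3 := @Ordinal 3 2 isT.
have pre j k (e : bpi3 B j ;; q = bpi3 B k ;; q) :
    bsum B (f j) (f k) (h ;; bplus B e).
  by rewrite -!hE; apply: sum_rel_pre; apply: bsum_bplus.
(* The compatibility proofs must be those of the associativity axiom, so that
   it rewrites on the nose. *)
have s1 := sum_rel_pre h
  (bsum_bplus (bplus_overl B (bpi3_comm B i0 i1) (bpi3_comm B i0 i2))).
have s2 := sum_rel_pre h
  (bsum_bplus (bplus_overr B (bpi3_comm B i1 i2) (bpi3_comm B i0 i1))).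
rewrite hE -(bsum_fun sxy (pre i0 i1 _)) in s1.
rewrite hE -(bsum_fun syz (pre i1 i2 _)) in s2.
rewrite (bsum_fun sw s1).
by rewrite [X in h ;; X](ab_assoc B).
Qed.

Lemma bsum0 (X : C) (x : hom X E) : bsum B x (x ;; q ;; bzero B) x.
Proof.
have := sum_rel_pre x (bsum_bplus (bunit_compat B)).
by rewrite (ab_unit B) !compm1 !compA.
Qed.

End BundleSum.

(** * Sums and cancellation in the tangent bundles *)

Section TangentSums.
Variables (C : category) (T : tangent_structure C).

Lemma tangent_bsum_nat (A B X : C) (f : hom A B) (x y z : hom X (T A)) :
  bsum (tbundle T A) x y z ->
  bsum (tbundle T B) (x ;; fmap T f) (y ;; fmap T f) (z ;; fmap T f).
Proof.
apply: sum_rel_post; rewrite tadd_nat.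
exact: (bsum_bplus (tbundle T B)
  (nat_pair_compat (tbundle T A) (tp_nat T f))).
Qed.

Lemma Tbsum_bplus (E M : C) (q : hom E M) (B : additive_bundle q)
    (s : stable_powers T B) (X : C) (x y : hom X (T E))
    (e : x ;; fmap T q = y ;; fmap T q) :
  Tbsum T B x y (bplus (tangent_image s) e).
Proof. exact: (bsum_bplus (tangent_image s)). Qed.

Lemma tc_p (A : C) : tc T A ;; tp T (T A) = fmap T (tp T A).
Proof. by rewrite (amor_over (tc_additive T A)) compm1. Qed.

Lemma tc_Tp (A : C) : tc T A ;; fmap T (tp T A) = tp T (T A).
Proof. by rewrite -tc_p compA tcc comp1m. Qed.

Lemma Tzero_tc (A : C) : fmap T (tzero T A) ;; tc T A = tzero T (T A).
Proof. by rewrite [LHS](amor_zero (tc_additive T A)) comp1m. Qed.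

Lemma tzero_tc (A : C) : tzero T (T A) ;; tc T A = fmap T (tzero T A).
Proof. by rewrite -Tzero_tc -compA tcc compm1. Qed.

Lemma tl_p (A : C) : tl T A ;; tp T (T A) = tp T A ;; tzero T A.
Proof. by rewrite -tlc -compA tc_p (amor_over (tl_additive T A)). Qed.

Lemma Tbsum_tc (A X : C) (x y z : hom X (T (T A))) :
  Tbsum T (tbundle T A) x y z ->
  bsum (tbundle T (T A)) (x ;; tc T A) (y ;; tc T A) (z ;; tc T A).
Proof.
apply: sum_rel_post.
rewrite [fmap T (badd _) ;; _](amor_add (tc_additive T A)).
exact: (bsum_bplus (tbundle T (T A))).
Qed.

(** The flip is an involution, so its additivity from [T(p)] to [p_T] can be
    reversed. *)
Lemma bsum_tc (A X : C) (x y z : hom X (T (T A))) :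
  bsum (tbundle T (T A)) x y z ->
  Tbsum T (tbundle T A) (x ;; tc T A) (y ;; tc T A) (z ;; tc T A).
Proof.
move=> sxyz; have e := bsum_over sxyz.
have e' : x ;; tc T A ;; fmap T (tp T A) = y ;; tc T A ;; fmap T (tp T A).
  by rewrite -!compA tc_Tp.
have s' := Tbsum_bplus (tpow_stable T A) e'.
have := Tbsum_tc s'; rewrite -!compA tcc !compm1 !compA => s''.
by rewrite (bsum_fun sxyz s'') -compA tcc compm1.
Qed.

Lemma bsum_tl (A X : C) (x y z : hom X (T A)) :
  bsum (tbundle T A) x y z ->
  Tbsum T (tbundle T A) (x ;; tl T A) (y ;; tl T A) (z ;; tl T A).
Proof.
apply: sum_rel_post; rewrite (amor_add (tl_additive T A)).
exact: (Tbsum_bplus (tpow_stable T A)).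
Qed.

Variable N : negatives T.

Lemma bsumN (A X : C) (x : hom X (T A)) :
  bsum (tbundle T A) x (x ;; tneg N A) (x ;; tp T A ;; tzero T A).
Proof.
have := sum_rel_pre x (bsum_bplus (tbundle T A) (neg_compat (tneg_over N A))).
by rewrite compm1 tneg_inv compA.
Qed.

Lemma bsum_cancel (A X : C) (x y z w : hom X (T A)) :
  bsum (tbundle T A) x z w -> bsum (tbundle T A) y z w -> x = y.
Proof.
move=> sx sy; have zN := bsumN z.
have ewz : w ;; tp T A = (z ;; tneg N A) ;; tp T A.
  by rewrite -compA tneg_over (bsum_overl sx) (bsum_over sx).
have sw := bsum_bplus (tbundle T A) ewz.
have shift v : bsum (tbundle T A) v z w -> v = bplus (tbundle T A) ewz.
  move=> sv; apply: bsum_fun (bsumA sv zN sw).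
  by rewrite -(bsum_over sv); apply: bsum0.
by rewrite (shift x) // (shift y).
Qed.

(** The flip turns the sums over [T(p)] into sums over [p_T], where
    [bsum_cancel] applies; this avoids any negation on [T(p)]. *)
Lemma Tbsum_cancel (A X : C) (x y z w : hom X (T (T A))) :
  Tbsum T (tbundle T A) x z w -> Tbsum T (tbundle T A) y z w -> x = y.
Proof.
move=> /Tbsum_tc sx /Tbsum_tc sy.
by have /(congr1 (comp^~ (tc T A))) := bsum_cancel sx sy;
  rewrite -!compA tcc !compm1.
Qed.

Lemma tsub_addK (A X : C) (x y : hom X (T A))
    (e : x ;; tp T A = y ;; tp T A) :
  bsum (tbundle T A) (tsub N e) y x.
Proof.
have sd := bsum_bplus (tbundle T A) (tsub_compat N e).
have ed : tsub N e ;; tp T A = y ;; tp T A by rewrite (bsum_overl sd).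
have sw := bsum_bplus (tbundle T A) ed.
have sx := bsumA sd (bsumC (bsumN y)) sw.
have ew : bplus (tbundle T A) ed = x.
  by apply: (bsum_fun sx); rewrite -e; apply: bsum0.
by rewrite ew in sw.
Qed.
End TangentSums.

(** * The map mu of a differential bundle *)

Section DiffBundle.
Variables (C : category) (T : tangent_structure C) (E M : C) (q : hom E M).
Variable Q : differential_bundle T q.

(** The map [lambda x 0] : [E_2 -> T(E_2)] through which [mu] is defined; it is
    also the map by which [mu] intertwines with [l], see [mu_tl]. *)
Lemma mu_lift : exists v : hom (bpow Q 2) (T (bpow Q 2)),
  [/\ v ;; fmap T (bpi0 Q) = bpi0 Q ;; db_lift Q,
      v ;; fmap T (bpi1 Q) = bpi1 Q ;; tzero T E & v ;; fmap T (badd Q) = mu Q].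
Proof.
exact: (Tbsum_bplus (db_pow_stable Q)
  (mu_compat Q (amor_over (db_lift_additive Q)) (tzero_nat T q))).
Qed.

(** The map [lambda x lambda], which intertwines [mu] with [T(lambda) c], see
    [mu_Tlift_tc]. *)
Lemma lift_pair : exists u : hom (bpow Q 2) (T (bpow Q 2)),
  [/\ u ;; fmap T (bpi0 Q) = bpi0 Q ;; db_lift Q,
      u ;; fmap T (bpi1 Q) = bpi1 Q ;; db_lift Q
    & u ;; fmap T (badd Q) = badd Q ;; db_lift Q].
Proof.
rewrite (amor_add (db_lift_additive Q)).
exact: (Tbsum_bplus (db_pow_stable Q)).
Qed.

(** [T] preserves the pullback square of [mu]; agreement on [T(pi_1)] gives
    agreement on the other leg, the base. *)
Lemma Tmu_inj (X : C) (h h' : hom X (T (bpow Q 2))) :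
  h ;; fmap T (mu Q) = h' ;; fmap T (mu Q) ->
  h ;; fmap T (bpi1 Q) = h' ;; fmap T (bpi1 Q) -> h = h'.
Proof.
move=> emu e1; apply: (pb_uniq (db_universal Q 1)); last exact: emu.
change (h ;; fmap T (wp_base (bpow Q 2)) = h' ;; fmap T (wp_base (bpow Q 2))).
by rewrite -(wp_comm (bpow Q 2) (@Ordinal 2 1 isT)) fmapM !compA [h ;; _]e1.
Qed.

Lemma Tbsum_mu (X : C) (h : hom X (bpow Q 2)) :
  Tbsum T Q (h ;; bpi0 Q ;; db_lift Q) (h ;; bpi1 Q ;; tzero T E) (h ;; mu Q).
Proof. by have := sum_rel_pre h mu_lift; rewrite !compA. Qed.

Lemma Tbsum_fun (X : C) (x y z z' : hom X (T E)) :
  Tbsum T Q x y z -> Tbsum T Q x y z' -> z = z'.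
Proof.
exact: (@sum_rel_fun _ _ _ _ (WidePullback (db_pow_stable Q 1 2))).
Qed.

Lemma TTbsum_fun (X : C) (x y z z' : hom X (T (T E))) :
  sum_rel (fmap T (fmap T (bpi0 Q))) (fmap T (fmap T (bpi1 Q)))
    (fmap T (fmap T (badd Q))) x y z ->
  sum_rel (fmap T (fmap T (bpi0 Q))) (fmap T (fmap T (bpi1 Q)))
    (fmap T (fmap T (badd Q))) x y z' -> z = z'.
Proof.
exact: (@sum_rel_fun _ _ _ _ (WidePullback (db_pow_stable Q 2 2))).
Qed.

Lemma Tbsum0 (X : C) (x : hom X (T E)) :
  Tbsum T Q x (x ;; fmap T q ;; fmap T (bzero Q)) x.
Proof.
have := sum_rel_pre x (sum_rel_fmap T (bsum0 Q (idm E))).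
by rewrite fmap1 comp1m fmapM compm1 !compA.
Qed.

Lemma Tbsum0l (X : C) (x : hom X (T E)) :
  Tbsum T Q (x ;; fmap T q ;; fmap T (bzero Q)) x x.
Proof.
have := sum_rel_pre x (sum_rel_fmap T (bsumC (bsum0 Q (idm E)))).
by rewrite fmap1 comp1m fmapM compm1 !compA.
Qed.

Lemma mu_unit_r (X : C) (h : hom X (bpow Q 2)) :
  h ;; bpi1 Q = h ;; bpi0 Q ;; q ;; bzero Q ->
  h ;; mu Q = h ;; bpi0 Q ;; db_lift Q.
Proof.
move=> e; apply: Tbsum_fun (Tbsum_mu h) _.
have -> : h ;; bpi1 Q ;; tzero T E
    = (h ;; bpi0 Q ;; db_lift Q) ;; fmap T q ;; fmap T (bzero Q).
  rewrite e -!compA -tzero_nat (compA (db_lift Q)).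
  by rewrite (amor_over (db_lift_additive Q)) !compA.
exact: Tbsum0.
Qed.

Lemma mu_unit_l (X : C) (h : hom X (bpow Q 2)) :
  h ;; bpi0 Q = h ;; bpi1 Q ;; q ;; bzero Q ->
  h ;; mu Q = h ;; bpi1 Q ;; tzero T E.
Proof.
move=> e; apply: Tbsum_fun (Tbsum_mu h) _.
have -> : h ;; bpi0 Q ;; db_lift Q
    = (h ;; bpi1 Q ;; tzero T E) ;; fmap T q ;; fmap T (bzero Q).
  rewrite e -!compA (compA (tzero T E)) [tzero T E ;; _]tzero_nat.
  by rewrite (amor_zero (db_lift_additive Q)) !compA.
exact: Tbsum0l.
Qed.

(** Both sides are sums over [T^2(q)]. Their summands agree because
    [lambda l = lambda T(lambda)] and [0 l = 0 T(0)]. *)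
Lemma mu_tl (v : hom (bpow Q 2) (T (bpow Q 2))) :
  v ;; fmap T (bpi0 Q) = bpi0 Q ;; db_lift Q ->
  v ;; fmap T (bpi1 Q) = bpi1 Q ;; tzero T E ->
  mu Q ;; tl T E = v ;; fmap T (mu Q).
Proof.
move=> v0 v1.
have sv := sum_rel_pre v (sum_rel_fmap T mu_lift).
rewrite (fmapM T (bpi0 Q)) (fmapM T (bpi1 Q)) in sv.
rewrite (compA v (fmap T (bpi0 Q))) (compA v (fmap T (bpi1 Q))) v0 v1 in sv.
apply: esym; apply: (TTbsum_fun sv).
have [w [w0 w1 <-]] := mu_lift.
exists (w ;; tl T (bpow Q 2)); split; rewrite -!compA tl_nat !compA.
- by rewrite w0 -!compA db_lift_lift.
- by rewrite w1 -!compA [tzero T E ;; _](amor_zero (tl_additive T E)).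
- by [].
Qed.

(** Both sides are sums over [T^2(q)], where the left one expands because
    [lambda] is additive. The summands agree because [lambda T(lambda)] equals
    [lambda l] and is therefore fixed by [c], while [c] turns the zero of [p_T]
    into the zero of [T(p)]. *)
Lemma mu_Tlift_tc (u : hom (bpow Q 2) (T (bpow Q 2))) :
  u ;; fmap T (bpi0 Q) = bpi0 Q ;; db_lift Q ->
  u ;; fmap T (bpi1 Q) = bpi1 Q ;; db_lift Q ->
  u ;; fmap T (badd Q) = badd Q ;; db_lift Q ->
  mu Q ;; (fmap T (db_lift Q) ;; tc T E) = u ;; fmap T (mu Q).
Proof.
move=> u0 u1 uD.
have su := sum_rel_pre u (sum_rel_fmap T mu_lift).
rewrite (fmapM T (bpi0 Q)) (fmapM T (bpi1 Q)) in su.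
rewrite (compA u (fmap T (bpi0 Q))) (compA u (fmap T (bpi1 Q))) u0 u1 in su.
apply: esym; apply: (TTbsum_fun su).
have [w [w0 w1 <-]] := mu_lift.
have lift_tc : db_lift Q ;; fmap T (db_lift Q) ;; tc T E
    = db_lift Q ;; fmap T (db_lift Q).
  by rewrite -db_lift_lift -compA tlc.
exists (w ;; fmap T u ;; tc T (bpow Q 2)).
split; rewrite -!compA tc_nat.
- rewrite (compA (fmap T u)) -fmapM u0 fmapM -!compA (compA w) w0.
  by rewrite -!compA (compA (db_lift Q)) lift_tc.
- rewrite (compA (fmap T u)) -fmapM u1 fmapM -!compA (compA w) w1.
  rewrite -!compA (compA (tzero T E)) [tzero T E ;; _]tzero_nat.
  by rewrite -compA tzero_tc.
- by rewrite (compA (fmap T u)) -fmapM uD fmapM !compA.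
Qed.

(** * Horizontal lifts *)

Lemma tme_ext (X : C) (h h' : hom X (TME Q)) :
  h ;; tme0 Q = h' ;; tme0 Q -> h ;; tme1 Q = h' ;; tme1 Q -> h = h'.
Proof. exact: (tme_uniq (k := 0)). Qed.

Lemma tme_Text (X : C) (h h' : hom X (T (TME Q))) :
  h ;; fmap T (tme0 Q) = h' ;; fmap T (tme0 Q) ->
  h ;; fmap T (tme1 Q) = h' ;; fmap T (tme1 Q) -> h = h'.
Proof. exact: (tme_uniq (k := 1)). Qed.

Lemma l_times_zero0 : l_times_zero Q ;; fmap T (tme0 Q) = tme0 Q ;; tl T M.
Proof. exact: (pb_pair0 (tme_stable Q 1)). Qed.

Lemma l_times_zero1 : l_times_zero Q ;; fmap T (tme1 Q) = tme1 Q ;; tzero T E.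
Proof. exact: (pb_pair1 (tme_stable Q 1)). Qed.

Lemma zero_times_lift0 :
  zero_times_lift Q ;; fmap T (tme0 Q) = tme0 Q ;; tzero T (T M).
Proof. exact: (pb_pair0 (tme_stable Q 1)). Qed.

Lemma zero_times_lift1 :
  zero_times_lift Q ;; fmap T (tme1 Q) = tme1 Q ;; db_lift Q.
Proof. exact: (pb_pair1 (tme_stable Q 1)). Qed.

(** A horizontal lift of a zero vector is zero. Linearity of [H] in its vector
    argument shows that such a lift [w] satisfies [w l = w 0_T]; composing with
    [p_T] gives [w = w p 0], since [l p_T = p 0] and [0_T p_T = 1]. *)
Lemma hc_zero (H : hom (TME Q) (T E)) (hH : horizontal_connection H)
    (X : C) (h : hom X (TME Q)) :
  h ;; tme0 Q = h ;; tme1 Q ;; q ;; tzero T M ->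
  h ;; H = h ;; tme1 Q ;; tzero T E.
Proof.
move=> h0.
have hl : h ;; l_times_zero Q = h ;; tzero T (TME Q).
  apply: tme_Text; rewrite -!compA tzero_nat.
  - rewrite l_times_zero0 !(compA h (tme0 Q)) h0 -!compA.
    rewrite [tzero T M ;; _](amor_zero (tl_additive T M)).
    by rewrite [bzero _ ;; _]tzero_nat.
  - by rewrite l_times_zero1.
have : h ;; H ;; tl T E = h ;; H ;; tzero T (T E).
  by rewrite -!compA (hc_linear_p hH) -tzero_nat compA hl -compA.
move/(congr1 (comp^~ (tp T (T E)))); rewrite -!compA tl_p.
rewrite [tzero _ _ ;; tp _ _]bzero_over compm1 => <-.
by rewrite (compA H) (hc_p hH) !compA.
Qed.

(** * The complement of the horizontal part *)

Section Splitting.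
Variables (N : negatives T) (H : hom (TME Q) (T E)).
Hypothesis hH : horizontal_connection H.
Variable f : hom (T E) (T E).
Hypothesis fUH : bsum (tbundle T E) f (U Q ;; H) (idm (T E)).

Lemma complement_p : f ;; tp T E = tp T E.
Proof. by rewrite (bsum_over fUH) UH_p. Qed.

(** Both [f T(q)] and the zero vector have sum [T(q)] with
    [UH T(q) = T(q)]. *)
Lemma complement_vertical : f ;; fmap T q = f ;; tp T E ;; q ;; tzero T M.
Proof.
apply: (bsum_cancel N (z := fmap T q) (w := fmap T q)).
  have := tangent_bsum_nat q fUH.
  by rewrite -compA (hc_Tq hH) U0 comp1m.
rewrite complement_p tp_nat.
exact: bsumC (bsum0 (tbundle T M) (fmap T q)).
Qed.

(** Both [H f] and the zero vector have sum [H] with [HUH = H]. *)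
Lemma H_complement : H ;; f = tme1 Q ;; tzero T E.
Proof.
have HU : H ;; U Q = idm (TME Q).
  by apply: tme_ext; rewrite comp1m -compA ?U0 ?U1 ?(hc_Tq hH) ?(hc_p hH).
apply: (bsum_cancel N (z := H) (w := H)).
  have := sum_rel_pre H fUH.
  by rewrite compA HU comp1m compm1.
rewrite -(hc_p hH); exact: bsumC (bsum0 (tbundle T E) H).
Qed.

(** [lambda] projects by [T(q)] to a zero vector, so [lambda UH] is zero and
    [lambda f + lambda UH = lambda] reduces to the claim. *)
Lemma lift_complement : db_lift Q ;; f = db_lift Q.
Proof.
have u0 : db_lift Q ;; U Q ;; tme0 Q = q ;; tzero T M.
  by rewrite -compA U0 (amor_over (db_lift_additive Q)).
have u1 : db_lift Q ;; U Q ;; tme1 Q = db_lift Q ;; tp T E.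
  by rewrite -compA U1.
have lq : db_lift Q ;; tp T E ;; q = q.
  rewrite (amor_over (db_lift_additive_p Q)) -compA bzero_over.
  exact: compm1.
have lU : db_lift Q ;; (U Q ;; H) = db_lift Q ;; tp T E ;; tzero T E.
  by rewrite compA (hc_zero hH) u1 // u0 lq.
have := sum_rel_pre (db_lift Q) fUH.
rewrite lU compm1 => sl; apply: bsum_fun sl.
have := bsum0 (tbundle T E) (db_lift Q ;; f).
by rewrite -!compA (compA f) complement_p.
Qed.

(** Apply [a] to [f + UH = 1], and [T] to the same equation followed by
    precomposition with [a]: the results have the same total [a] and the same
    second summand, hence the same first summand. *)
Lemma complement_comm (a : hom (T E) (T (T E))) :
  (forall x y z : hom (T E) (T E), bsum (tbundle T E) x y z ->
    Tbsum T (tbundle T E) (x ;; a) (y ;; a) (z ;; a)) ->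
  U Q ;; H ;; a = a ;; fmap T (U Q ;; H) ->
  a ;; fmap T f = f ;; a.
Proof.
move=> aD aUH.
have s1 := aD _ _ _ fUH.
have s2 := sum_rel_pre a (sum_rel_fmap T fUH).
rewrite comp1m aUH in s1; rewrite fmap1 compm1 in s2.
exact: (Tbsum_cancel N s2 s1).
Qed.

Lemma complement_tl : tl T E ;; fmap T f = f ;; tl T E.
Proof.
apply: complement_comm => [x y z|]; first exact: bsum_tl.
rewrite fmapM -compA (hc_linear_p hH) !compA; congr (_ ;; _).
apply: tme_Text; rewrite -!compA -!fmapM ?U0 ?U1.
- by rewrite l_times_zero0 compA U0 tl_nat.
- rewrite l_times_zero1 compA U1.
  by rewrite (amor_over (tl_additive T E)).
Qed.

Lemma complement_Tlift_tc :
  fmap T (db_lift Q) ;; tc T E ;; fmap T f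
  = f ;; (fmap T (db_lift Q) ;; tc T E).
Proof.
apply: complement_comm => [x y z sxyz|].
  by rewrite !compA; apply: bsum_tc; apply: tangent_bsum_nat.
rewrite fmapM -(compA (U Q)) (compA H) (hc_linear_Tq hH) !compA.
congr (_ ;; _); apply: tme_Text; rewrite -!compA -!fmapM ?U0 ?U1.
- rewrite zero_times_lift0 tc_nat compA U0.
  rewrite (compA (fmap T (db_lift Q))) -!fmapM.
  by rewrite (amor_over (db_lift_additive Q)) fmapM -compA Tzero_tc.
- by rewrite zero_times_lift1 tc_Tp compA U1 tp_nat.
Qed.

(** * The bracket as a connection *)

Variable e : f ;; fmap T q = f ;; tp T E ;; q ;; tzero T M.
Let m := mu_factor Q e.
Let K := bracket Q e.

Lemma bracket_mu1 : m ;; bpi1 Q = tp T E.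
Proof. by rewrite -mu_p compA mu_factorK complement_p. Qed.

(** The common source of both linearity conditions: [a T(<K,p>) = <K,p> v] can
    be tested after [T(mu)], where it becomes [a T(f) = f a], and after
    [T(pi_1)], where it becomes [a T(p) = p b]. *)
Lemma bracket_comm (a : hom (T E) (T (T E))) (b : hom E (T E))
    (v : hom (bpow Q 2) (T (bpow Q 2))) :
  v ;; fmap T (bpi0 Q) = bpi0 Q ;; db_lift Q ->
  v ;; fmap T (bpi1 Q) = bpi1 Q ;; b ->
  a ;; fmap T (tp T E) = tp T E ;; b ->
  mu Q ;; a = v ;; fmap T (mu Q) ->
  a ;; fmap T f = f ;; a ->
  K ;; db_lift Q = a ;; fmap T K.
Proof.
move=> v0 v1 ap mua af.
have am : a ;; fmap T m = m ;; v.
  apply: Tmu_inj; rewrite -!compA -?fmapM.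
  - by rewrite mu_factorK af -mua compA mu_factorK.
  - by rewrite bracket_mu1 ap v1 compA bracket_mu1.
by rewrite /K /bracket fmapM (compA a) am -!compA v0.
Qed.

Lemma bracket_vertical : vertical_connection Q K.
Proof.
split.
- (* [w = <1, q 0_q>], which [mu] sends to [lambda]. *)
  pose w := bpair Q (bunit_compat Q).
  have w0 : w ;; bpi0 Q = idm E by apply: wpair0.
  have w1 : w ;; bpi1 Q = q ;; bzero Q by apply: wpair1.
  suff lm : db_lift Q ;; m = w by rewrite /K /bracket compA [_ ;; m]lm w0.
  apply: mu_factor_uniq; rewrite -compA mu_factorK lift_complement.
  by rewrite mu_unit_r ?w0 ?w1 !comp1m.
- rewrite /K /bracket -compA (_ : bpi0 Q ;; q = bpi1 Q ;; q); last first.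
    exact: wpi_comm.
  by rewrite compA bracket_mu1.
- have [v [v0 v1 _]] := mu_lift.
  apply: (bracket_comm v0 v1).
  + exact: amor_over (tl_additive T E).
  + exact: mu_tl.
  + exact: complement_tl.
- have [u [u0 u1 uD]] := lift_pair.
  apply: (bracket_comm u0 u1).
  + by rewrite -compA tc_Tp tp_nat.
  + exact: mu_Tlift_tc.
  + exact: complement_Tlift_tc.
Qed.

Lemma bracket_connection : connection K H.
Proof.
apply: (Connection (cn_vertical := bracket_vertical) (cn_horizontal := hH)).
- have ew : tme1 Q ;; q ;; bzero Q ;; q = tme1 Q ;; q.
    by rewrite -compA bzero_over compm1.
  (* [w = <pi_1 q 0_q, pi_1>], which [mu] sends to the zero vector [H f]. *)
  pose w := bpair Q ew.
  have w0 : w ;; bpi0 Q = tme1 Q ;; q ;; bzero Q by apply: wpair0.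
  have w1 : w ;; bpi1 Q = tme1 Q by apply: wpair1.
  suff Hm : H ;; m = w by rewrite /K /bracket compA [_ ;; m]Hm w0.
  apply: mu_factor_uniq; rewrite -compA mu_factorK H_complement.
  by rewrite mu_unit_l ?w0 ?w1.
- apply: bplus_bsum.
  suff -> : bpair Q (vc_over bracket_vertical) = m.
    by rewrite mu_factorK; apply: fUH.
  apply: wpair_uniq; first exact: wpair0.
  by rewrite [LHS]wpair1; apply: esym bracket_mu1.
Qed.

End Splitting.
End DiffBundle.

Theorem proposition5p12 (C : category) (T : tangent_structure C)
    (N : negatives T) (E M : C) (q : hom E M) (Q : differential_bundle T q)
    (H : hom (TME Q) (T E)) (hH : horizontal_connection H) :
  exists e : one_sub_UH N hH ;; fmap T q
             = one_sub_UH N hH ;; tp T E ;; q ;; tzero T M,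
    connection (bracket Q e) H.
Proof.
have fUH : bsum (tbundle T E) (one_sub_UH N hH) (U Q ;; H) (idm (T E)).
  exact: tsub_addK.
by exists (complement_vertical N hH fUH); apply: bracket_connection.
Qed.
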